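(* Define $\overline{H}(\Delta) := \sum_{\ell=1}^K H\big(\lfloor Y_\ell/\delta + U_\ell\rceil \,\big|\, U_\ell\big)$. Then for $0<\Delta<1/6$, $$\overline{H}(\Delta) = \sum_{\ell=1}^K\Big[ h\big(s\star u_{\sqrt{12\gamma}\,\pi\ell/K}\big) - \log\frac{\pi\ell\sqrt{12\gamma}}{K}\Big],$$ and consequently $$\lim_{\Delta\to0^+}\Delta\cdot\overline{H}(\Delta) = \frac{2}{\pi^2}\left(\int_0^1 h\big(s\star u_{\pi x\sqrt{12\gamma}}\big)\,dx - \log\big(\pi\sqrt{12\gamma}/e\big)\right).$$
   Context: Let $U$ be uniformly distributed on $[0,1]$ and let the sawbridge be $X(t) = t-\mathbf{1}(t\ge U)$, $t\in[0,1]$. Let $\phi_k(t)=\sqrt2\sin(\pi k t)$ and $Y_k = \int_0^1 X(t)\phi_k(t)\,dt$. Let $\gamma>0$ be the unique solution of $\arctan(\pi\sqrt{\gamma}) = \frac{1}{\pi\sqrt{\gamma}}$. Given $\Delta$, set $D = \frac{\Delta^2\pi^2}{4}$, $K = \big\lceil \frac{1}{\pi\sqrt D}\big\rceil$, and $\delta = \frac{\sqrt{12\gamma}}{K}$. Let $U_1,\ldots,U_K$ be i.i.d. uniform on $[-1/2,1/2]$, independent of $U$; $\lfloor\cdot\rceil$ denotes rounding to the nearest integer, and $H(\cdot\mid\cdot)$ is conditional (discrete) entropy. $s$ is the arcsine density on $[-\sqrt2,\sqrt2]$, $s(x) = \frac{1}{\pi\sqrt{(\sqrt2-x)(\sqrt2+x)}}$;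 $u_a$ is the uniform density on $[-a/2,a/2]$; $\star$ denotes convolution; $h(\cdot)$ is differential entropy of a density. All logarithms are base 2. *)

(* Defs.v *)
From HB Require Import structures.
From mathcomp Require Import all_boot all_order all_algebra.
From mathcomp Require Import all_classical all_reals all_analysis.
Set Implicit Arguments. Unset Strict Implicit. Unset Printing Implicit Defensive.
Import Order.TTheory GRing.Theory Num.Theory.
Import numFieldNormedType.Exports.
Local Open Scope classical_set_scope.
Local Open Scope ring_scope.

Section Defs.
Variable R : realType.

Definition log2 (x : R) : R := ln x / ln 2.

(* rounding to the nearest integer (ties rounded up; ties have prob. 0) *)
Definition round_near (x : R) : int := Num.floor (x + 2^-1).

(* the uniform random variable U on [0,1] : the sample space is R with
   the uniform probability on [0,1], U is the identity *)
Definition Pu : probability _ R := uniform_prob (@ltr01 R).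

Definition sawbridge (u t : R) : R := t - (if u <= t then 1 else 0).

Definition phi (k : nat) (t : R) : R := Num.sqrt 2 * sin (pi * k%:R * t).

Definition Ycoef (k : nat) (u : R) : R :=
  Rintegral (@lebesgue_measure R) `[0, 1] (fun t => sawbridge u t * phi k t).

Definition ent_term (p : R) : R := if p == 0 then 0 else - (p * log2 p).

Definition dentropy (Z : R -> int) : R :=
  fine (\esum_(n in [set: int]) (ent_term (fine (Pu [set u | Z u = n])))%:E).

Lemma lt_mhalf_half : - 2^-1 < (2^-1 : R).
Proof. by rewrite gtrN // invr_gt0 ltr0n. Qed.
Definition Pv : probability _ R := uniform_prob lt_mhalf_half.

(* H( g(U, U_l) | U_l ) for U_l ~ Unif[-1/2,1/2] independent of U:
   H(Z | U_l) = E_{v ~ U_l}[ H(Z | U_l = v) ] = int H(g(U, v)) dP_{U_l}(v) *)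
Definition cond_entropy_dither (g : R -> R -> int) : R :=
  Rintegral Pv setT (fun v => dentropy (fun u => g u v)).

Definition Dpar (Delta : R) : R := Delta ^+ 2 * pi ^+ 2 / 4.
Definition Kpar (Delta : R) : nat :=
  `| Num.ceil ((pi * Num.sqrt (Dpar Delta))^-1) |%N.
Definition deltapar (gamma Delta : R) : R :=
  Num.sqrt (12 * gamma) / (Kpar Delta)%:R.

Definition Hbar (gamma Delta : R) : R :=
  \sum_(1 <= l < (Kpar Delta).+1)
     cond_entropy_dither
       (fun u v => round_near (Ycoef l u / deltapar gamma Delta + v)).

Definition arcsine_dens (x : R) : R :=
  if (- Num.sqrt 2 < x) && (x < Num.sqrt 2) then
    (pi * Num.sqrt ((Num.sqrt 2 - x) * (Num.sqrt 2 + x)))^-1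
  else 0.
Definition unif_dens (a x : R) : R :=
  if (- (a / 2) <= x) && (x <= a / 2) then a^-1 else 0.
Definition convol (f g : R -> R) (x : R) : R :=
  Rintegral (@lebesgue_measure R) setT (fun y => f y * g (x - y)).
Definition diff_entropy (f : R -> R) : R :=
  Rintegral (@lebesgue_measure R) setT (fun x => ent_term (f x)).

End Defs.

(* Main.v *)
Require Import Defs.
From HB Require Import structures.
From mathcomp Require Import all_boot all_order all_algebra.
From mathcomp Require Import all_classical all_reals all_analysis.
From mathcomp Require Import measurable_realfun.
From mathcomp Require Import zify ring lra.
Import Order.TTheory GRing.Theory Num.Theory.
Import numFieldNormedType.Exports.
Local Open Scope classical_set_scope.
Local Open Scope ring_scope.

(** The coefficient is [Y_l = - sqrt 2 * cos (pi l U) / (pi l)], so [pi l Y_l]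
    has the arcsine law, with distribution function [S]. With
    [a = pi l delta] and [q = s * u_a], that is
    [q x = (S (x + a/2) - S (x - a/2)) / a], the quantized dithered coefficient
    equals [n] with probability [a q((n - v) a)] when the dither is [v].
    Averaging the entropy over [v] in [[-1/2, 1/2]] makes the intervals of
    length [a] centred at the [n a] tile the line, so it gives
    [a^-1 * \int ent (a q) = h(q) - log a]; the same tiling, applied to [q] and
    a telescoping sum, gives [\int q = 1].
    The limit is the convergence of the Riemann sums of
    [x |-> h(s * u_(c x)) - log (c x)] with [c = pi sqrt(12 gamma)], by dominated
    convergence on step functions: nonnegativity of the discrete entropy is the
    bound [log a <= h(s * u_a)], which makes the singularity at [0] at most
    logarithmic. *)

(** * The fundamental theorem of calculus on an open interval *)

Section improper_FTC.
Context {R : realType}.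
Notation mu := (@lebesgue_measure R).

(** The integrand may blow up at both ends, as the arcsine density does. The theorem for closed
    intervals applies to an exhausting sequence [A n]; the integrals converge by monotonicity since
    [f] is nonnegative, the increments by continuity of [F] on the line. *)
Lemma ge0_continuous_FTC2_oo (f F : R -> R) (a b : R) : a < b ->
  {in `]a, b[, forall x, 0 <= f x} -> {in `]a, b[, continuous f} ->
  continuous F -> {in `]a, b[, forall x : R, is_derive x (1 : R) F (f x)} ->
  (\int[mu]_(x in `]a, b[) (f x)%:E = (F b - F a)%:E)%E.
Proof.
move=> ab f0 cf cF dF.
(* The shift by 3 gives [e n <= (b - a) / 3], so that [a + e n < b - e n] already at [n = 0]. *)
pose e n : R := (b - a) / n.+3%:R.
have e0 n : 0 < e n by rewrite divr_gt0// subr_gt0.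
have ele n : e n <= (b - a) / 3.
  rewrite ler_pM2l ?subr_gt0// lef_pV2 ?posrE ?ltr0n// ler_nat; lia.
have e_cvg : e @ \oo --> (0 : R).
  rewrite -(mulr0 (b - a)); apply: cvgM; first exact: cvg_cst.
  have := @cvg_harmonic R; rewrite -(cvg_shiftn 2); apply: cvg_trans.
  by apply: near_eq_cvg; near=> n; rewrite /= addn2.
pose A n : set R := `[a + e n, b - e n]%classic.
have A_sub n : A n `<=` `]a, b[.
  move=> x; rewrite /A/= !in_itv/= => /andP[ax xb]; have := e0 n.
  by move=> en; apply/andP; split; lra.
have A_bigcup : `]a, b[%classic = \bigcup_n A n.
  apply/seteqP; split=> x; last by move=> [n _ /A_sub].
  rewrite /= in_itv/= => /andP[ax xb].
  have m0 : 0 < Num.min (x - a) (b - x) by rewrite lt_min !subr_gt0 ax.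
  have [N _ HN] : \forall n \near \oo, e n < Num.min (x - a) (b - x).
    exact: (cvgr_lt _ e_cvg).
  exists N => //; rewrite /A/= in_itv/=.
  have := HN N (leqnn N); rewrite /= lt_min => /andP[? ?].
  by apply/andP; split; lra.
have A_int n : (\int[mu]_(x in A n) (f x)%:E = (F (b - e n) - F (a + e n))%:E)%E.
  have en := e0 n; have ln := ele n.
  have sub x : x \in `[a + e n, b - e n] -> x \in `]a, b[.
    by move=> xA; have := A_sub n x; rewrite /A/= => /(_ xA).
  rewrite EFinB; apply: continuous_FTC2; first lra.
  - by apply: continuous_in_subspaceT => x; rewrite inE/= => /sub; exact: cf.
  - split.
    + move=> x xi; have /dF[] // : x \in `]a, b[.
      by apply: sub; exact: subset_itv_oo_cc xi.
    + exact/cvg_at_right_filter/cF.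
    + exact/cvg_at_left_filter/cF.
  - move=> x xi; have /dF dFx : x \in `]a, b[.
      by apply: sub; exact: subset_itv_oo_cc xi.
    by rewrite derive1E derive_val.
have cvg1 : (\int[mu]_(x in A n) (f x)%:E)%E @[n --> \oo] --> (\int[mu]_(x in `]a, b[) (f x)%:E)%E.
  rewrite A_bigcup; apply: ge0_nondecreasing_set_cvg_integral.
  - apply/nondecreasing_seqP => n; rewrite subsetEset => x.
    rewrite /A/= !in_itv/= => /andP[ax xb].
    have : e n.+1 <= e n.
      by rewrite ler_pM2l ?subr_gt0// lef_pV2 ?posrE ?ltr0n// ler_nat.
    by move=> ?; apply/andP; split; lra.
  - by move=> n; exact: measurable_itv.
  - move=> n; apply/measurable_EFinP; apply: (@subspace_continuous_measurable_fun _ (A n)); first exact: measurable_itv.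
    apply: continuous_in_subspaceT => x; rewrite inE => /A_sub; exact: cf.
  - by move=> n x /A_sub xi; rewrite lee_fin; exact: f0.
have cvg2 : (\int[mu]_(x in A n) (f x)%:E)%E @[n --> \oo] --> (F b - F a)%:E.
  under eq_cvg do rewrite A_int.
  apply: cvg_EFin; first exact: nearW.
  apply: cvgB; apply: continuous_cvg.
  - exact: cF.
  - rewrite -[X in _ --> X]subr0; apply: cvgB => //; exact: cvg_cst.
  - exact: cF.
  - rewrite -[X in _ --> X]addr0; apply: cvgD => //; exact: cvg_cst.
exact: cvg_unique cvg1 cvg2.
Unshelve. all: by end_near. Qed.

End improper_FTC.

(** * The arcsine distribution function *)

Section arcsine_cdf.
Context {R : realType}.
Notation mu := (@lebesgue_measure R).
Notation sqrt2 := (Num.sqrt (2 : R)).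

Definition clip (x : R) : R := Num.max (-1) (Num.min 1 x).

Lemma clip_itv x : -1 <= clip x <= 1.
Proof. by rewrite /clip le_max lexx/= ge_max ge_min lexx/= andbT; lra. Qed.

Lemma clip_id x : -1 <= x <= 1 -> clip x = x.
Proof. by rewrite /clip => /andP[h1 h2]; rewrite (min_idPr h2) (max_idPr h1). Qed.

Lemma clip_ge1 x : 1 <= x -> clip x = 1.
Proof. by move=> h; rewrite /clip (min_idPl h); apply/max_idPr; lra. Qed.

Lemma clip_leN1 x : x <= -1 -> clip x = -1.
Proof. by move=> h; rewrite /clip (_ : Num.min 1 x = x); [exact/max_idPl|apply/min_idPr; lra]. Qed.

(** As inverse of the monotone [cos] on [[0, pi]], [acos] is continuous only within [[-1, 1]]. Since
    [clip] is continuous with values there, the composite is continuous on the whole line. *)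
Lemma continuous_acos_clip : continuous (fun x => acos (clip x)).
Proof.
have cac : {within `[-1, 1], continuous (@acos R)}.
  rewrite -(@cospi R) -(@cos0 R); apply: segment_can_ge_continuous => //.
  - exact: pi_ge0.
  - by apply: continuous_subspaceT; exact: continuous_cos.
  - exact: cosK.
have gin y : `[-1, 1]%classic (clip y) by rewrite /= in_itv; exact: clip_itv.
have gc : continuous clip.
  rewrite (_ : clip = (cst (-1) \max (cst 1 \min id)))//.
  apply: max_fun_continuous; first by move=> ?; exact: cvg_cst.
  apply: min_fun_continuous => ?; last exact: cvg_id.
  exact: cvg_cst.
move=> x; move/subspace_continuousP: cac => /(_ (clip x) (gin x)) cx.
apply: (cvg_comp _ _ _ cx) => P /= wP.
have h : nbhs x (clip @^-1` (fun z => `[-1, 1]%classic z -> P z)) := gc x _ wP.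
by apply: (filterS _ h) => y; apply; exact: gin.
Qed.

Lemma sqrt2_gt0 : 0 < sqrt2. Proof. by rewrite sqrtr_gt0. Qed.

Lemma sqr_sqrt2 : sqrt2 ^+ 2 = 2. Proof. by rewrite sqr_sqrtr. Qed.

(** Written with [acos] because this is directly the probability that [- sqrt2 * cos (pi * U) < x];
    the clipping makes it 0 and 1 outside the support. *)
Definition arcsine_cdf (x : R) : R := acos (clip (- x / sqrt2)) / pi.

Notation S := arcsine_cdf.

Lemma continuous_arcsine_cdf : continuous S.
Proof.
move=> x; apply: cvgM; last exact: cvg_cst.
have h : {for x, continuous (fun x : R => - x / sqrt2)}.
  by apply: cvgM; [apply: cvgN; exact: cvg_id|exact: cvg_cst].
exact: (continuous_comp h (continuous_acos_clip _)).
Qed.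

Lemma arcsine_cdf_le x : x <= - sqrt2 -> S x = 0.
Proof.
move=> h; rewrite /S clip_ge1 ?acos1 ?mul0r//.
by rewrite ler_pdivlMr ?sqrt2_gt0// mul1r lerNr.
Qed.

Lemma arcsine_cdf_ge x : sqrt2 <= x -> S x = 1.
Proof.
move=> h; rewrite /S clip_leN1 ?acosN1 ?divff ?gt_eqF ?pi_gt0//.
by rewrite ler_pdivrMr ?sqrt2_gt0// mulN1r lerN2.
Qed.

Lemma arcsine_cdf_ge0 x : 0 <= S x.
Proof. by rewrite divr_ge0 ?pi_ge0// acos_ge0// clip_itv. Qed.

Lemma arcsine_cdf_le1 x : S x <= 1.
Proof. by rewrite ler_pdivrMr ?pi_gt0// mul1r acos_lepi// clip_itv. Qed.

Lemma is_derive_arcsine_cdf (x : R) : x \in `](- sqrt2), sqrt2[ ->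
  is_derive x (1 : R) S (arcsine_dens x).
Proof.
have s0 := sqrt2_gt0.
rewrite in_itv/= => /andP[xl xr].
have xB : -1 < - x / sqrt2 < 1.
  by rewrite ltr_pdivlMr// ltr_pdivrMr// mulN1r mul1r ltrN2 ltrNl xr.
pose g (y : R) : R := acos (- y / sqrt2) / pi.
have dg : is_derive x (1 : R) g (arcsine_dens x).
  have da := is_derive1_acos xB.
  have dl : is_derive x (1 : R) (fun y : R => - y / sqrt2) (- 1 / sqrt2).
    by apply: is_derive_eq; rewrite ?scaler0 ?add0r ?addr0; rewrite -mulr_algl /GRing.scale/=; ring.
  have dc := @is_derive1_comp R (@acos R) (fun y : R => - y / sqrt2) x _ _ da dl.
  have : is_derive x (1 : R) (fun y : R => (acos \o (fun y : R => - y / sqrt2)) y * pi^-1) (arcsine_dens x).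
    apply: is_derive_eq.
    rewrite /arcsine_dens xl xr/= scaler0 add0r.
    have -> : (sqrt2 - x) * (sqrt2 + x) = 2 * (1 - (- x / sqrt2) ^+ 2).
      transitivity (sqrt2 ^+ 2 * (1 - (- x / sqrt2) ^+ 2)); last by rewrite sqr_sqrt2.
      by field; exact: lt0r_neq0.
    rewrite sqrtrM// /GRing.scale/=.
    by rewrite !invfM; ring.
  by [].
apply: (@near_eq_is_derive _ _ _ g) => //.
near=> y; rewrite /g /S clip_id//.
have : -1 < - y / sqrt2 < 1.
  rewrite ltr_pdivlMr// ltr_pdivrMr// mulN1r mul1r ltrN2 ltrNl.
  by apply/andP; split; near: y; [exact: lt_nbhsl|exact: lt_nbhsr].
by move=> /andP[? ?]; rewrite !ltW.
Unshelve. all: by end_near. Qed.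

Lemma arcsine_dens_ge0 (x : R) : 0 <= arcsine_dens x.
Proof.
rewrite /arcsine_dens; case: ifPn => // _.
by rewrite invr_ge0 mulr_ge0 ?pi_ge0// sqrtr_ge0.
Qed.

Lemma arcsine_dens_out (x : R) : x \notin `](- sqrt2), sqrt2[ -> arcsine_dens x = 0.
Proof. by rewrite in_itv/= /arcsine_dens => /negbTE ->. Qed.

Lemma continuous_arcsine_dens : {in `](- sqrt2), sqrt2[, continuous (@arcsine_dens R)}.
Proof.
move=> x xi; have := xi; rewrite in_itv/= => /andP[xl xr].
pose g (y : R) := (pi * Num.sqrt ((sqrt2 - y) * (sqrt2 + y)))^-1.
have cg : {for x, continuous g}.
  apply: cvgV.
    rewrite mulf_neq0 ?gt_eqF ?pi_gt0// sqrtr_gt0 mulr_gt0// ?subr_gt0//; lra.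
  apply: cvgM; first exact: cvg_cst.
  have h : {for x, continuous (fun y : R => (sqrt2 - y) * (sqrt2 + y))}.
    apply: cvgM; [apply: cvgB|apply: cvgD]; try exact: cvg_cst; exact: cvg_id.
  exact: (continuous_comp h (@sqrt_continuous R _)).
rewrite /prop_for /continuous_at.
have -> : arcsine_dens x = g x by rewrite /arcsine_dens xl xr.
apply: cvg_trans cg; apply: near_eq_cvg; near=> y.
rewrite /arcsine_dens ifT//; apply/andP; split; near: y.
- exact: lt_nbhsr.
- exact: lt_nbhsl.
Unshelve. all: by end_near. Qed.

Lemma measurable_arcsine_dens : measurable_fun setT (@arcsine_dens R).
Proof.
have -> : @arcsine_dens R = @arcsine_dens R \_ `](- sqrt2), sqrt2[.
  apply/funext => x; rewrite patchE; case: ifPn => //.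
  by rewrite notin_setE/= => /negP; exact: arcsine_dens_out.
apply/(measurable_restrictT _ _).1 => //.
apply: open_continuous_measurable_fun; first exact: interval_open.
by move=> x; rewrite inE/=; exact: continuous_arcsine_dens.
Qed.

Lemma arcsine_cdf_max x : S (Num.max x (- sqrt2)) = S x.
Proof.
case: (lerP x (- sqrt2)) => h; last by [].
by rewrite !arcsine_cdf_le.
Qed.

Lemma arcsine_cdf_min x : S (Num.min x sqrt2) = S x.
Proof.
case: (lerP x sqrt2) => h; first by [].
by rewrite !arcsine_cdf_ge// ltW.
Qed.

(** The density vanishes outside the open support and [S] is constant there, so [a] and [b] can be
    clamped to the support, where the open-interval theorem applies despite the poles at its
    ends. *)
Lemma integral_arcsine_dens (a b : R) : a <= b ->
  (\int[mu]_(x in `[a, b]) (arcsine_dens x)%:E = (S b - S a)%:E)%E.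
Proof.
have s0 := sqrt2_gt0.
move=> ab; pose a' := Num.max a (- sqrt2); pose b' := Num.min b sqrt2.
rewrite -(arcsine_cdf_min b) -(arcsine_cdf_max a) -/a' -/b'.
rewrite integral_itv_bndoo; last first.
  by apply/measurable_EFinP; apply: measurable_funS measurable_arcsine_dens.
transitivity (\int[mu]_(x in `]a', b'[) (arcsine_dens x)%:E)%E.
  rewrite integral_mkcond [RHS]integral_mkcond; apply: eq_integral => x _.
  have := @arcsine_dens_out x.
  rewrite !patchE !mem_setE !in_itv/= gt_max lt_min.
  case: (ltP a x) => //= _; case: (ltP x b) => //= _;
  case: (ltP (- sqrt2) x) => //= _; case: (ltP x sqrt2) => //= _;
  by [move=> _|move=> ->].
have [ab'|ba'] := ltP a' b'.
  apply: ge0_continuous_FTC2_oo => //.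
  - by move=> x _; exact: arcsine_dens_ge0.
  - move=> x; rewrite in_itv/= gt_max lt_min => /andP[/andP[_ x1] /andP[_ x2]].
    by apply: continuous_arcsine_dens; rewrite in_itv/= x1.
  - exact: continuous_arcsine_cdf.
  - move=> x; rewrite in_itv/= gt_max lt_min => /andP[/andP[_ x1] /andP[_ x2]].
    by apply: is_derive_arcsine_cdf; rewrite in_itv/= x1.
rewrite set_itv_ge ?integral_set0 -?leNgt//.
congr EFin; apply/esym/eqP; rewrite subr_eq0.
(* The clamped interval is empty: either [a = b], or both points lie on the same side of the
   support, where [S] is constant; the last case contradicts [0 < sqrt2]. *)
move: ba'; rewrite arcsine_cdf_max arcsine_cdf_min ge_min.
rewrite !le_max => /orP[/orP[|]|/orP[|]] h.
- by rewrite (_ : a = b)//; lra.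
- by rewrite !arcsine_cdf_le//; lra.
- by rewrite !arcsine_cdf_ge//; lra.
- lra.
Qed.

Lemma arcsine_cdf_homo : {homo S : x y / x <= y}.
Proof.
move=> x y xy; rewrite -subr_ge0 -lee_fin -integral_arcsine_dens//.
by apply: integral_ge0 => z _; rewrite lee_fin arcsine_dens_ge0.
Qed.

End arcsine_cdf.

(** * Bounds, scaling and continuity of the entropy summand *)

Section entropy_term.
Context {R : realType}.

Lemma ln2_gt0 : 0 < ln (2 : R).
Proof. by rewrite ln_gt0// ltr1n. Qed.

Lemma ent_termE (p : R) : ent_term p = - (p * ln p) / ln 2.
Proof.
rewrite /ent_term /log2; case: ifPn => [/eqP ->|_]; last by rewrite mulrA mulNr.
by rewrite mul0r oppr0 mul0r.
Qed.

Lemma ent_term0 : ent_term (0 : R) = 0.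
Proof. by rewrite /ent_term eqxx. Qed.

(** From [ln (1 + y) <= y] at [y = p^-1 - 1]: [- p ln p <= 1 - p <= 1]. *)
Lemma ent_term_le (p : R) : 0 <= p -> ent_term p <= (ln 2)^-1.
Proof.
rewrite le_eqVlt => /predU1P[<-|p0].
  by rewrite ent_term0 invr_ge0 ltW// ln2_gt0.
rewrite ent_termE ler_pdivrMr ?ln2_gt0// mulVf ?gt_eqF ?ln2_gt0//.
have : ln (1 + (p^-1 - 1)) <= p^-1 - 1.
  by apply: le_ln1Dx; rewrite ltrBrDl subrr invr_gt0.
rewrite addrC subrK lnV ?posrE// => h.
have := ler_wpM2l (ltW p0) h; rewrite mulrBr divff ?gt_eqF// mulr1 mulrN.
lra.
Qed.

(** A constant majorant for dominated convergence. The lower bound uses [ln p < p], hence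
    [p ln p <= M ^+ 2]. *)
Lemma norm_ent_term_le (p M : R) : 0 <= p -> p <= M ->
  `|ent_term p| <= (1 + M ^+ 2) / ln 2.
Proof.
move=> p0 pM; rewrite ler_norml; apply/andP; split.
- rewrite ent_termE -mulNr ler_pM2r ?invr_gt0 ?ln2_gt0// lerN2.
  move: p0; rewrite le_eqVlt => /predU1P[<-|p0].
    by rewrite mul0r addr_ge0 ?sqr_ge0.
  have := ltW (ln_sublinear p0) => h; have := ler_wpM2l (ltW p0) h.
  by nra.
- apply: le_trans (ent_term_le p p0) _; apply: ler_peMl.
    by rewrite invr_ge0 (ltW ln2_gt0).
  by rewrite lerDl sqr_ge0.
Qed.

Lemma ent_term_ge0 (p : R) : 0 <= p -> p <= 1 -> 0 <= ent_term p.
Proof.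
move=> p0 p1; rewrite ent_termE divr_ge0 ?(ltW ln2_gt0)// -mulrN mulr_ge0//.
by rewrite oppr_ge0 ln_le0.
Qed.

(** Passes from cell probabilities [a * q] to the density [q]. The correction is linear in [p], so
    it integrates to [a * log2 a] once [q] has integral 1. *)
Lemma ent_termM (a p : R) : 0 < a -> 0 <= p ->
  ent_term (a * p) = a * ent_term p - a * log2 a * p.
Proof.
move=> a0; rewrite le_eqVlt => /predU1P[<-|p0].
  by rewrite mulr0 ent_term0 !mulr0 subr0.
by rewrite !ent_termE /log2 lnM ?posrE//; ring.
Qed.

(** This is [ln y < y] at [y = (Num.sqrt x)^-1]. It bounds [|x ln x|] by [2 * Num.sqrt x] on []0,
    1]], which gives continuity at 0. *)
Lemma ln_ge_sqrtN (x : R) : 0 < x -> - 2 * (Num.sqrt x)^-1 <= ln x.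
Proof.
move=> x0; have s0 : 0 < Num.sqrt x by rewrite sqrtr_gt0.
have := @ln_sublinear _ (Num.sqrt x)^-1; rewrite invr_gt0 => /(_ s0).
rewrite lnV ?posrE// => h.
rewrite -[in leRHS](sqr_sqrtr (ltW x0)) lnXn// mulr2n; lra.
Qed.

Lemma continuous_xlnx : continuous (fun p : R => p * ln p).
Proof.
move=> p; case: (ltrgtP p 0) => [p0|p0|->].
- apply: (near_cst_continuous 0); near=> q.
  rewrite ln0 ?mulr0//; apply: ltW; near: q; exact: lt_nbhsl.
- by apply: cvgM; [exact: cvg_id|exact: continuous_ln].
- rewrite /continuous_at mul0r; apply/cvgr0Pnorm_le => e e0.
  have c : (fun q : R => 2 * Num.sqrt q) q @[q --> (0:R)] --> 2 * Num.sqrt (0:R).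
    by apply: cvgM; [exact: cvg_cst|exact: sqrt_continuous].
  rewrite sqrtr0 mulr0 in c.
  have c1 : \forall q \near (0:R), 2 * Num.sqrt q < e by exact: (cvgr_lt _ c).
  near=> q.
  have q1 : q < 1 by near: q; exact: lt_nbhsl.
  have [q0|q0] := leP q 0; first by rewrite ln0// mulr0 normr0 ltW.
  rewrite ltW//; apply: le_lt_trans (_ : 2 * Num.sqrt q < e); last by near: q.
  have s0 : 0 < Num.sqrt q by rewrite sqrtr_gt0.
  have := ln_ge_sqrtN _ q0 => h.
  rewrite ler0_norm; last by rewrite mulr_ge0_le0 ?ln_le0// ltW.
  rewrite -mulrN.
  have : q * - ln q <= q * (2 * (Num.sqrt q)^-1) by rewrite ler_pM2l//; lra.
  move=> /le_trans; apply.
  by rewrite -{1}(sqr_sqrtr (ltW q0)) expr2 mulrCA -mulrA divff ?mulr1// gt_eqF.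
Unshelve. all: by end_near. Qed.

Lemma continuous_ent_term : continuous (@ent_term R).
Proof.
have -> : @ent_term R = (fun p => - (p * ln p) / ln 2).
  by apply/funext => p; exact: ent_termE.
move=> p; apply: cvgM; last exact: cvg_cst.
by apply: cvgN; exact: continuous_xlnx.
Qed.

End entropy_term.

(** * The arcsine density convolved with a uniform density *)

Section dithered_density.
Context {R : realType}.
Notation mu := (@lebesgue_measure R).
Notation sqrt2 := (Num.sqrt (2 : R)).
Notation S := (@arcsine_cdf R).

Definition dith_dens (a x : R) : R := (S (x + a / 2) - S (x - a / 2)) / a.

(* At [a = 0] both sides are [0] since [0^-1 = 0]; this case is the endpoint
   [x = 0] of the integral in the theorem. *)
Lemma convol_arcsine_unif (a : R) : 0 <= a ->
  convol (@arcsine_dens R) (unif_dens a) = dith_dens a.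
Proof.
move=> a0; apply/funext => x; rewrite /convol /Rintegral.
have xx : x - a / 2 <= x + a / 2 by lra.
transitivity (fine (\int[mu]_(y in `[(x - a / 2)%R, (x + a / 2)%R]) (a^-1%:E * (arcsine_dens y)%:E)%E)).
  congr fine; rewrite [RHS]integral_mkcond; apply: eq_integral => y _.
  rewrite patchE mem_setE in_itv/= /unif_dens.
  have -> : (- (a / 2) <= x - y) && (x - y <= a / 2) = (x - a / 2 <= y <= x + a / 2).
    by apply/andP/andP => -[? ?]; split; lra.
  by case: ifPn => _; rewrite ?mulr0// mulrC.
rewrite ge0_integralZl//=.
- by rewrite integral_arcsine_dens// -EFinM /= /dith_dens mulrC.
- apply/measurable_EFinP; exact: measurable_funS measurable_arcsine_dens.
- by move=> y _; rewrite lee_fin arcsine_dens_ge0.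
- by rewrite lee_fin invr_ge0.
Qed.

Lemma dith_dens_ge0 (a x : R) : 0 < a -> 0 <= dith_dens a x.
Proof.
move=> a0; apply: divr_ge0; last exact: ltW.
by rewrite subr_ge0 arcsine_cdf_homo//; lra.
Qed.

Lemma dith_densM_le1 (a x : R) : 0 < a -> a * dith_dens a x <= 1.
Proof.
move=> a0; rewrite mulrC divfK ?gt_eqF//.
by have := arcsine_cdf_le1 (x + a / 2); have := arcsine_cdf_ge0 (x - a / 2); lra.
Qed.

Lemma dith_dens_le (a x : R) : 0 < a -> dith_dens a x <= a^-1.
Proof. by move=> a0; rewrite -[a^-1]mulr1 ler_pdivlMl// dith_densM_le1. Qed.

Lemma dith_dens_out (a x : R) : 0 < a -> sqrt2 + a / 2 <= `|x| ->
  dith_dens a x = 0.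
Proof.
move=> a0; rewrite ler_normr /dith_dens => /orP[] h.
- by rewrite !arcsine_cdf_ge ?subrr ?mul0r//; lra.
- by rewrite !arcsine_cdf_le ?subrr ?mul0r//; lra.
Qed.

Lemma continuous_dith_dens (a : R) : continuous (dith_dens a).
Proof.
move=> x; apply: cvgM; last exact: cvg_cst.
by apply: cvgB; (apply: (@cvg_comp _ _ _ _ S _ _ _ _ (@continuous_arcsine_cdf R _)));
  [apply: cvgD|apply: cvgB]; try exact: cvg_id; exact: cvg_cst.
Qed.

Lemma cvg_dith_dens (a_ : nat -> R) (a x : R) : a != 0 -> a_ @ \oo --> a ->
  dith_dens (a_ n) x @[n --> \oo] --> dith_dens a x.
Proof.
move=> a0 cv; apply: cvgM; last exact: cvgV.
have cv2 : a_ n / 2 @[n --> \oo] --> a / 2 by apply: cvgM => //; exact: cvg_cst.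
by apply: cvgB; (apply: (@cvg_comp _ _ _ _ S _ _ _ _ (@continuous_arcsine_cdf R _)));
  [apply: cvgD|apply: cvgB] => //; exact: cvg_cst.
Qed.

End dithered_density.

(** * Unfolding an integral over the line into unit dither cells *)

Section unfolding.
Context {R : realType}.
Notation mu := (@lebesgue_measure R).

Lemma continuous_sum (I : Type) (r : seq I) (f : I -> R -> R) :
  (forall i, continuous (f i)) -> continuous (fun x => \sum_(i <- r) f i x).
Proof.
move=> cf; elim: r => [|i r IH].
  rewrite (_ : (fun x => _) = cst 0); first by move=> ?; exact: cvg_cst.
  by apply/funext => x; rewrite big_nil.
rewrite (_ : (fun x => _) = (fun x => f i x + \sum_(j <- r) f j x)).
  by move=> x; apply: cvgD; [exact: cf|exact: IH].
by apply/funext => x; rewrite big_cons.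
Qed.

Lemma continuous_integrable_itv (f : R -> R) (a b : R) : continuous f ->
  mu.-integrable `[a, b] (EFin \o f).
Proof.
move=> cf; apply: continuous_compact_integrable; first exact: segment_compact.
exact: continuous_subspaceT.
Qed.

Lemma Rintegral_continuous_sum (I : Type) (r : seq I) (f : I -> R -> R) (a b : R) :
  (forall i, continuous (f i)) ->
  Rintegral mu `[a, b] (fun x => \sum_(i <- r) f i x) =
  \sum_(i <- r) Rintegral mu `[a, b] (f i).
Proof.
move=> cf; elim: r => [|i r IH].
  rewrite big_nil (_ : (fun x => _) = cst 0); first by rewrite Rintegral_cst//= mul0r.
  by apply/funext => x; rewrite big_nil.
rewrite big_cons -IH -RintegralD//.
- by apply: eq_Rintegral => x _; rewrite big_cons.
- exact: continuous_integrable_itv.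
- by apply: continuous_integrable_itv; exact: continuous_sum.
Qed.

Lemma Rintegral_itv_sum (f : R -> R) (x : nat -> R) (n : nat) : continuous f ->
  {homo x : i j / (i <= j)%N >-> i <= j} ->
  \sum_(i < n) Rintegral mu `[x i, x i.+1] f = Rintegral mu `[x 0%N, x n] f.
Proof.
move=> cf hx; elim: n => [|n IH].
  by rewrite big_ord0 set_itv1 Rintegral_set1.
rewrite big_ord_recr/= IH.
have := @Rintegral_itvB R f (BLeft (x 0%N)) (BRight (x n.+1)) (x n).
move=> /(_ (continuous_integrable_itv _ _ _ cf)).
rewrite !bnd_simp => /(_ (hx 0%N n (leq0n n)) (hx n n.+1 (leqnSn n))) E.
suff -> : Rintegral mu `[x n, x n.+1] f = Rintegral mu `]x n, x n.+1] f.
  by rewrite -E addrC subrK.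
apply/esym/Rintegral_itv_obnd_cbnd.
apply: integrableS (continuous_integrable_itv f (x n) (x n.+1) cf) => //.
by apply: subset_itvr; rewrite bnd_simp.
Qed.

Lemma Rintegral_supported (f : R -> R) (a b : R) :
  (forall x, x \notin `[a, b] -> f x = 0) ->
  Rintegral mu setT f = Rintegral mu `[a, b] f.
Proof.
move=> f0; rewrite [RHS]Rintegral_mkcond; apply: eq_Rintegral => x _.
by rewrite patchE mem_setE; case: ifPn => // /f0.
Qed.

Lemma continuous_supported_integrable (f : R -> R) (a b : R) : continuous f ->
  (forall x, x \notin `[a, b] -> f x = 0) -> mu.-integrable setT (EFin \o f).
Proof.
move=> cf f0; rewrite (_ : EFin \o f = (EFin \o f) \_ `[a, b]).
  by apply/(integrable_mkcond _ _).1 => //; exact: continuous_integrable_itv.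
apply/funext => x; rewrite patchE mem_setE/=.
by case: ifPn => // /f0 ->.
Qed.

Lemma integrable_scale (f : R -> R) (c : R) : mu.-integrable setT (EFin \o f) ->
  mu.-integrable setT (EFin \o (fun x => c * f x)).
Proof.
move=> h; have := @integrableZl _ _ _ mu setT measurableT c _ h.
exact: eq_integrable.
Qed.

(** The substitution [x = (k - v) * c], decreasing because the dither is subtracted from the cell
    index; the upper limit is left as the image of [v = - 2^-1]. *)
Lemma Rintegral_flip (f : R -> R) (c k : R) : 0 < c -> continuous f ->
  Rintegral mu `[(k - 2^-1) * c, (k - - 2^-1) * c] f =
  Rintegral mu `[- 2^-1, 2^-1] (fun v => c * f ((k - v) * c)).
Proof.
move=> c0 cf; rewrite /Rintegral.
pose F (v : R) := (k - v) * c.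
have dF (v : R) : is_derive v (1 : R) F (- c).
  rewrite (_ : F = (fun v => (k - v) * c))//.
  by apply: is_derive_eq; rewrite /GRing.scale/=; ring.
have F' : derive1 F = cst (- c).
  by apply/funext => v; rewrite derive1E derive_val.
have cF : continuous F.
  by move=> v; apply: cvgM; [apply: cvgB; [exact: cvg_cst|exact: cvg_id]|exact: cvg_cst].
rewrite (@integration_by_substitution_decreasing R F f (- 2^-1) 2^-1).
- congr fine; apply: eq_integral => v _.
  by rewrite fctE F' /= opprK mulrC.
- lra.
- by move=> x y _ _ xy; rewrite /F ltr_pM2r// ltrD2l ltrN2.
- by rewrite F' => x _; exact: cvg_cst.
- by rewrite F'; exact: is_cvg_cst.
- by rewrite F'; exact: is_cvg_cst.
- split.
  + by move=> x _; apply: ex_derive.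
  + exact/cvg_at_right_filter/cF.
  + exact/cvg_at_left_filter/cF.
- exact: continuous_subspaceT.
Qed.

(** The support of [f] is covered by the [2 M + 1] cells of length [c] centred at [(i - M) * c];
    flipping each cell turns the sum of cell integrals into one integral over the dither. *)
Lemma Rintegral_dither (f : R -> R) (c : R) (M : nat) : 0 < c -> continuous f ->
  (forall x, (M%:R + 2^-1) * c <= `|x| -> f x = 0) ->
  Rintegral mu setT f =
  c * Rintegral mu `[- 2^-1, 2^-1]
    (fun v => \sum_(i < (M + M).+1) f ((i%:R - M%:R - v) * c)).
Proof.
move=> c0 cf f0.
pose x (i : nat) : R := (i%:R - M%:R - 2^-1) * c.
have hx : {homo x : i j / (i <= j)%N >-> i <= j}.
  by move=> i j ij; rewrite ler_pM2r// !lerD2r ler_nat.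
have cfi (i : nat) : continuous (fun v : R => f ((i%:R - M%:R - v) * c)).
  move=> v; apply: (@cvg_comp _ _ _ _ f _ _ _ _ (cf _)).
  by apply: cvgM; [apply: cvgB; [exact: cvg_cst|exact: cvg_id]|exact: cvg_cst].
rewrite (Rintegral_supported f (x 0%N) (x (M + M).+1)); last first.
  move=> y; rewrite in_itv/= /x => yx; apply: f0; rewrite ler_normr.
  have MM : (M + M).+1%:R = M%:R + M%:R + 1 :> R by rewrite -natrD natr1.
  move: yx; rewrite negb_and -!ltNge MM => /orP[] h; apply/orP;
  [right|left]; lra.
rewrite -Rintegral_itv_sum//.
rewrite -RintegralZl//; last first.
  apply: continuous_integrable_itv.
  by apply: continuous_sum => i; exact: cfi.
transitivity (Rintegral mu `[- 2^-1, 2^-1]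
    (fun v => \sum_(i < (M + M).+1) c * f ((i%:R - M%:R - v) * c))); last first.
  by apply: eq_Rintegral => v _; rewrite mulr_sumr.
rewrite Rintegral_continuous_sum; last first.
  move=> i v; apply: cvgM; [exact: cvg_cst|exact: cfi].
apply: eq_bigr => i _; rewrite -Rintegral_flip// /x.
suff -> : i.+1%:R - M%:R - 2^-1 = i%:R - M%:R - - 2^-1 :> R by [].
have -> : i.+1%:R = i%:R + 1 :> R by rewrite natr1.
lra.
Qed.

End unfolding.

(** * Averaged discrete entropy as differential entropy *)

Section dithered_entropy.
Context {R : realType}.
Notation mu := (@lebesgue_measure R).
Notation sqrt2 := (Num.sqrt (2 : R)).
Notation S := (@arcsine_cdf R).

(** With cells of length [a], the value [a * q] at a cell's point is an increment of [S]; for each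
    [v] these increments telescope from 0 to 1. *)
Lemma Rintegral_dith_dens (a : R) : 0 < a ->
  Rintegral mu setT (dith_dens a) = 1.
Proof.
move=> a0; pose M := Num.bound (sqrt2 / a).
(* Ensures that the support of [q], of half-width [sqrt2 + a / 2], lies within the half-width
   [(M + 1/2) * a] of the cells. *)
have Ma : sqrt2 < M%:R * a.
  rewrite -ltr_pdivrMr//; apply: archi_boundP.
  by rewrite divr_ge0 ?sqrtr_ge0// ltW.
rewrite (Rintegral_dither (dith_dens a) a M) => //; last 2 first.
- exact: continuous_dith_dens.
- by move=> x h; apply: dith_dens_out => //; apply: le_trans h; nra.
rewrite -RintegralZl//; last first.
  apply: continuous_integrable_itv; apply: continuous_sum => i v.
  apply: (@cvg_comp _ _ _ _ (dith_dens a) _ _ _ _ (continuous_dith_dens _ _)).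
  by apply: cvgM; [apply: cvgB; [exact: cvg_cst|exact: cvg_id]|exact: cvg_cst].
transitivity (Rintegral mu `[- 2^-1, 2^-1] (cst (1 : R))); last first.
  rewrite Rintegral_cst//= mul1r lebesgue_measure_itv/= lte_fin ifT; last lra.
  by rewrite -EFinD /=; lra.
apply: eq_Rintegral => v; rewrite mem_setE in_itv/= => /andP[v1 v2].
pose T (i : nat) := S ((i%:R - M%:R - v) * a - a / 2).
rewrite mulr_sumr.
transitivity (\sum_(0 <= i < (M + M).+1) (T i.+1 - T i)).
  rewrite big_mkord; apply: eq_bigr => i _.
  rewrite /dith_dens mulrC divfK ?gt_eqF// /T; congr (S _ - _).
  by rewrite -natr1; field.
rewrite telescope_sumr// /T arcsine_cdf_ge ?arcsine_cdf_le ?subr0//.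
- by nra.
- have -> : (M + M).+1%:R = M%:R + M%:R + 1 :> R by rewrite -natrD natr1.
  by nra.
Qed.

Lemma continuous_ent_dith_dens (a : R) : continuous (fun x => ent_term (dith_dens a x)).
Proof.
move=> x.
exact: (@cvg_comp _ _ _ _ (@ent_term R) _ _ _ (continuous_dith_dens _ _) (continuous_ent_term _)).
Qed.

Lemma dith_dens_supp (a x : R) : 0 < a ->
  x \notin `[- (sqrt2 + a / 2), sqrt2 + a / 2] -> dith_dens a x = 0.
Proof.
move=> a0; rewrite in_itv/= -ler_norml -ltNge => /ltW; exact: dith_dens_out.
Qed.

Lemma integrable_dith_dens (a : R) : 0 < a ->
  mu.-integrable setT (EFin \o dith_dens a).
Proof.
move=> a0; apply: continuous_supported_integrable; first exact: continuous_dith_dens.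
by move=> x; exact: dith_dens_supp.
Qed.

Lemma integrable_ent_dith_dens (a : R) : 0 < a ->
  mu.-integrable setT (EFin \o (fun x => ent_term (dith_dens a x))).
Proof.
move=> a0; apply: continuous_supported_integrable; first exact: continuous_ent_dith_dens.
by move=> x xi; rewrite dith_dens_supp ?ent_term0//; exact: xi.
Qed.

Lemma dithered_entropy (a : R) (M : nat) : 0 < a -> sqrt2 <= M%:R * a ->
  Rintegral mu `[- 2^-1, 2^-1]
    (fun v => \sum_(i < (M + M).+1) ent_term (a * dith_dens a ((i%:R - M%:R - v) * a)))
  = diff_entropy (dith_dens a) - log2 a.
Proof.
move=> a0 Ma; apply: (mulfI (lt0r_neq0 a0)).
rewrite -(Rintegral_dither (fun y => ent_term (a * dith_dens a y)) a M)//; last 2 first.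
- move=> x; apply: (@cvg_comp _ _ _ _ (@ent_term R) _ _ _ _ (continuous_ent_term _)).
  by apply: cvgM; [exact: cvg_cst|exact: continuous_dith_dens].
- move=> x h; rewrite dith_dens_out ?mulr0 ?ent_term0//.
  by apply: le_trans h; nra.
transitivity (Rintegral mu setT (fun y => a * ent_term (dith_dens a y)
   - (a * log2 a) * dith_dens a y)).
  by apply: eq_Rintegral => y _; rewrite ent_termM// dith_dens_ge0.
rewrite RintegralB//.
- rewrite RintegralZl//; last exact: integrable_ent_dith_dens.
  rewrite RintegralZl//; last exact: integrable_dith_dens.
  by rewrite Rintegral_dith_dens// mulr1 /diff_entropy mulrBr.
- by apply: integrable_scale => //; exact: integrable_ent_dith_dens.
- by apply: integrable_scale => //; exact: integrable_dith_dens.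
Qed.

Lemma diff_entropy_ge (a : R) : 0 < a -> log2 a <= diff_entropy (dith_dens a).
Proof.
move=> a0; pose M := Num.bound (sqrt2 / a).
have Ma : sqrt2 <= M%:R * a.
  rewrite -ler_pdivrMr//; apply/ltW/archi_boundP.
  by rewrite divr_ge0 ?sqrtr_ge0// ltW.
rewrite -subr_ge0 -(dithered_entropy a M)//.
apply: Rintegral_ge0 => v _; apply: sumr_ge0 => i _.
apply: ent_term_ge0; last exact: dith_densM_le1.
by rewrite mulr_ge0 ?(ltW a0)// dith_dens_ge0.
Qed.

Lemma diff_entropy_le (a : R) : 0 < a ->
  diff_entropy (dith_dens a) <= (2 * sqrt2 + a) / ln 2.
Proof.
move=> a0; rewrite /diff_entropy.
have s0 := @sqrt2_gt0 R.
rewrite (Rintegral_supported _ (- (sqrt2 + a / 2)) (sqrt2 + a / 2)); last first.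
  by move=> x xi; rewrite dith_dens_supp ?ent_term0//; exact: xi.
apply: (@le_trans _ _ (Rintegral mu `[- (sqrt2 + a / 2), sqrt2 + a / 2] (cst (ln 2)^-1))).
  apply: le_Rintegral => //.
  - by apply: continuous_integrable_itv; exact: continuous_ent_dith_dens.
  - by apply: continuous_integrable_itv => ?; exact: cvg_cst.
  - by move=> x _; apply: ent_term_le; exact: dith_dens_ge0.
rewrite Rintegral_cst//= lebesgue_measure_itv/= lte_fin ifT; last lra.
rewrite -EFinD /= mulrC ler_pM2r ?invr_gt0 ?ln2_gt0//; lra.
Qed.

(** Dominated convergence: the lower bound [a] on the widths bounds the densities by [a^-1], and the
    upper bound [A] puts the supports in one compact interval. Approach from above suffices for
    sampling at right endpoints. *)
Lemma cvg_diff_entropy (a_ : nat -> R) (a A : R) : 0 < a ->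
  (forall n, a <= a_ n) -> (forall n, a_ n <= A) -> a_ @ \oo --> a ->
  diff_entropy (dith_dens (a_ n)) @[n --> \oo] --> diff_entropy (dith_dens a).
Proof.
move=> a0 ale leA cv.
pose B := sqrt2 + A.
pose D : R := (1 + a^-1 ^+ 2) / ln 2.
pose g (x : R) : \bar R := (D * \1_`[- B, B] x)%:E.
have [] := @dominated_convergence _ _ R mu setT measurableT
  (fun n x => (ent_term (dith_dens (a_ n) x))%:E)
  (fun x => (ent_term (dith_dens a x))%:E) g.
- move=> n; apply/measurable_EFinP; apply: continuous_measurable_fun.
  exact: continuous_ent_dith_dens.
- apply/measurable_EFinP; apply: continuous_measurable_fun.
  exact: continuous_ent_dith_dens.
- apply: aeW => x _; apply: cvg_EFin; first exact: nearW.
  apply: (@cvg_comp _ _ _ _ (@ent_term R) _ _ _ _ (continuous_ent_term _)).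
  by apply: cvg_dith_dens => //; rewrite gt_eqF.
- rewrite /g; under eq_fun do rewrite EFinM.
  by apply: integrableZl => //; exact: integrable_indic_itv.
- apply: aeW => x n _; rewrite /g lee_fin.
  have an0 : 0 < a_ n by exact: lt_le_trans (ale n).
  have [xB|xB] := boolP (x \in `[- B, B]).
    rewrite indicE mem_setE xB mulr1; apply: norm_ent_term_le.
      exact: dith_dens_ge0.
    by rewrite (le_trans (dith_dens_le _ _ an0))// lef_pV2.
  rewrite indicE mem_setE (negbTE xB) mulr0 dith_dens_out ?ent_term0 ?normr0//.
  move: xB; rewrite in_itv/= -ler_norml -ltNge => /ltW; apply: le_trans.
  by have := leA n; rewrite /B; lra.
move=> _ _ h.
by apply: fine_cvg; rewrite fineK//; apply: integrable_fin_num => //; exact: integrable_ent_dith_dens.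
Qed.

End dithered_entropy.

(** * Closed form of the sine coefficients of the sawbridge *)

Section sawbridge_coefficient.
Context {R : realType}.
Notation mu := (@lebesgue_measure R).
Notation sqrt2 := (Num.sqrt (2 : R)).
Notation S := (@arcsine_cdf R).

Lemma Rintegral_FTC2 (f F : R -> R) (a b : R) : a <= b -> continuous f ->
  (forall x : R, is_derive x (1 : R) F (f x)) ->
  Rintegral mu `[a, b] f = F b - F a.
Proof.
rewrite le_eqVlt => /predU1P[-> _ _|ab cf dF].
  by rewrite set_itv1 Rintegral_set1 subrr.
have cF : continuous F.
  by move=> x; apply/differentiable_continuous/derivable1_diffP; apply: ex_derive.
rewrite /Rintegral (@continuous_FTC2 R f F)//.
- exact: continuous_subspaceT.
- split; first by move=> x _; apply: ex_derive.
  + exact/cvg_at_right_filter/cF.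
  + exact/cvg_at_left_filter/cF.
- by move=> x _; rewrite derive1E derive_val.
Qed.

(** The integral of [t * phi l t] over [[0, 1]] minus that of [phi l] over [[u, 1]], by explicit
    antiderivatives. As [sin (pi * l) = 0], the boundary terms at 1 cancel and only the cosine at
    [u] remains. *)
Lemma Ycoef_cos (l : nat) (u : R) : (0 < l)%N -> 0 <= u -> u <= 1 ->
  Ycoef l u = - sqrt2 * cos (pi * l%:R * u) / (pi * l%:R).
Proof.
move=> l0 u0 u1; pose k : R := pi * l%:R.
have k0 : k != 0 by rewrite mulf_neq0 ?gt_eqF ?pi_gt0 ?ltr0n.
have dl (t : R) : is_derive t (1 : R) (fun t : R => k * t) k.
  by apply: is_derive_eq; rewrite /GRing.scale/=; ring.
have dc (t : R) : is_derive t (1 : R) (fun t : R => cos (k * t)) (- sin (k * t) * k).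
  exact: (@is_derive1_comp R (@cos R) (fun t : R => k * t)).
have ds (t : R) : is_derive t (1 : R) (fun t : R => sin (k * t)) (cos (k * t) * k).
  exact: (@is_derive1_comp R (@sin R) (fun t : R => k * t)).
have cphi : continuous (@phi R l).
  move=> t; apply: cvgM; first exact: cvg_cst.
  apply/differentiable_continuous/derivable1_diffP.
  by have [] := ds t.
have ctphi : continuous (fun t : R => t * phi l t).
  by move=> t; apply: cvgM; [exact: cvg_id|exact: cphi].
rewrite /Ycoef.
transitivity (Rintegral mu `[0, 1] (fun t => t * phi l t - (@phi R l \_ `[u, 1]) t)).
  apply: eq_Rintegral => t; rewrite mem_setE in_itv/= => /andP[t0 t1].
  rewrite patchE mem_setE in_itv/= t1 andbT /sawbridge.
  case: ifPn => _; first by ring.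
  by rewrite subr0; apply/esym; exact: subr0.
rewrite RintegralB//; last 2 first.
- exact: continuous_integrable_itv.
- rewrite -restrict_EFin; apply/integrable_restrict => //=.
  apply: integrableS (continuous_integrable_itv _ u 1 cphi) => //.
  exact: measurableI.
rewrite -Rintegral_mkcondr (_ : `[0, 1] `&` `[u, 1] = `[u, 1]%classic); last first.
  apply/seteqP; split=> t /=; rewrite !in_itv/=; first by move=> [_ ->].
  by move=> /andP[ut t1]; rewrite (le_trans u0 ut) t1 ut.
have dF1 (t : R) : is_derive t (1 : R) (fun t : R =>
    sqrt2 * (- (t * cos (k * t)) / k + sin (k * t) / k ^+ 2)) (t * phi l t).
  by apply: is_derive_eq; rewrite /GRing.scale/= /phi -/k; field; exact: k0.
have dF2 (t : R) : is_derive t (1 : R) (fun t : R => - sqrt2 * cos (k * t) / k)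
    (phi l t).
  by apply: is_derive_eq; rewrite /GRing.scale/= /phi -/k; field; exact: k0.
rewrite (Rintegral_FTC2 _ _ _ _ ler01 ctphi dF1) (Rintegral_FTC2 _ _ _ _ u1 cphi dF2).
have -> : sin (k * 1) = 0.
  rewrite mulr1 /k mulr_natr -[_ *+ _]add0r (alternatingn (@sinDpi R)).
  by rewrite sin0 mulr0.
by rewrite !mulr0 sin0 -/k; field; exact: k0.
Qed.

End sawbridge_coefficient.

(** * The arcsine law of the coefficients and the quantizer's probabilities *)

Section cosine_law.
Context {R : realType}.
Notation mu := (@lebesgue_measure R).
Notation sqrt2 := (Num.sqrt (2 : R)).
Notation S := (@arcsine_cdf R).

Let above (l : nat) (t : R) : set R := [set u | t < cos (pi * l%:R * u)].

Let measurable_above l t : measurable (above l t).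
Proof.
have h : measurable_fun setT (fun u : R => cos (pi * l%:R * u)).
  apply: continuous_measurable_fun => u.
  apply: (@cvg_comp _ _ _ _ (@cos R) _ _ _ _ (@continuous_cos R _)).
  by apply: cvgM; [exact: cvg_cst|exact: cvg_id].
have := h measurableT _ (measurable_itv `]t, +oo[).
by rewrite setTI; congr measurable; apply/seteqP; split => u /=; rewrite in_itv/= andbT.
Qed.

(** Here [pi * l * u] runs over one half-period, on which the cosine is monotone. The superlevel set
    is thus an interval at the left end ([j] even) or the right end ([j] odd), of the same length in
    both cases. *)
Lemma mu_cos_period (l j : nat) (t : R) : (0 < l)%N ->
  mu (`[j%:R / l%:R, j.+1%:R / l%:R[ `&` above l t) =
  (acos (clip t) / (pi * l%:R))%:E.
Proof.
move=> l0; have l0' : 0 < l%:R :> R by rewrite ltr0n.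
have p0 := @pi_gt0 R.
have jS : j.+1%:R = j%:R + 1 :> R by rewrite natr1.
rewrite jS.
have [t1|t1] := leP 1 t.
  rewrite clip_ge1// acos1 mul0r (_ : _ `&` _ = set0) ?measure0//.
  apply/seteqP; split => // u [_]; rewrite /above/= => /(le_lt_trans t1).
  by rewrite ltNge cos_le1.
have [tN1|tN1] := ltP t (-1).
  rewrite clip_leN1 ?ltW// acosN1 setIidl; last first.
    by move=> u _; rewrite /above/=; apply: lt_le_trans (cos_geN1 _).
  rewrite lebesgue_measure_itv/= lte_fin ltr_pM2r ?invr_gt0// ltrDl ltr01.
  rewrite -EFinD; congr EFin; rewrite mulrDl addrC addrA addNr add0r mul1r.
  by rewrite invfM mulrA divff ?mul1r// gt_eqF.
have tB : -1 <= t <= 1 by rewrite tN1 ltW.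
rewrite clip_id//; set a := acos t.
have a0 : 0 < a by rewrite acos_gt0// tN1.
have api : a <= pi by rewrite acos_lepi.
have ca : cos a = t by rewrite acosK.
have aI : a \in `[0, pi] by rewrite in_itv/= ltW.
have len (x y : R) : 0 < y -> (x + y / pi) / l%:R - x / l%:R = y / (pi * l%:R).
  by move=> y0; rewrite mulrDl addrAC subrr add0r invfM mulrA.
have cosE (u : R) : cos (pi * l%:R * u) = (-1) ^+ j * cos (pi * (l%:R * u - j%:R)).
  rewrite -(alternatingn (@cosDpi R)) -mulr_natr; congr cos; ring.
case: (boolP (odd j)) => oj.
- have -> : `[j%:R / l%:R, (j%:R + 1) / l%:R[ `&` above l t =
      `](j%:R + 1 - a / pi) / l%:R, (j%:R + 1) / l%:R[%classic.
    have E (u : R) : j%:R <= l%:R * u -> l%:R * u < j%:R + 1 ->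
        (t < cos (pi * l%:R * u)) = (j%:R + 1 - a / pi < l%:R * u).
      move=> u1 u2; rewrite cosE -signr_odd oj expr1 mulN1r -cosDpi.
      (* For odd [j] the angle is reflected into [[0, pi]], measured back from the right end, so
         that the monotonicity of [cos] on that interval applies. *)
      have -> : cos (pi * (l%:R * u - j%:R) + pi) = cos (pi * (j%:R + 1 - l%:R * u)).
        rewrite cosDpi -[RHS]cosN; apply/esym.
        rewrite (_ : - (pi * (j%:R + 1 - l%:R * u)) = pi * (l%:R * u - j%:R) - pi); last ring.
        have := cosDpi (pi * (l%:R * u - j%:R) - pi); rewrite subrK => ->.
        by rewrite opprK.
      rewrite -ca ltr_cos//; last first.
        by rewrite in_itv/=; apply/andP; split; nra.
      rewrite ltrBlDl -ltrBlDr [RHS]ltr_pdivlMr// [in RHS]mulrC.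
      by [].
    apply/seteqP; split => u /=; rewrite !in_itv/= !ltr_pdivrMr// !ltr_pdivlMr// ?ler_pdivrMr//.
    + by move=> [/andP[u1 u2]]; rewrite /above/= E ?[l%:R * u]mulrC// => ->.
    + move=> /andP[u1 u2].
      have ju : j%:R <= u * l%:R.
        apply: le_trans (ltW u1); rewrite -addrA lerDl subr_ge0.
        by rewrite ler_pdivrMr// mul1r.
      by rewrite ju u2 /above/= E ?[l%:R * u]mulrC.
  rewrite lebesgue_measure_itv/= lte_fin ifT; last first.
    by rewrite ltr_pM2r ?invr_gt0// ltrBlDr ltrDl divr_gt0.
  by rewrite -EFinD -(len (j%:R + 1 - a / pi))// subrK.
- have -> : `[j%:R / l%:R, (j%:R + 1) / l%:R[ `&` above l t =
      `[j%:R / l%:R, (j%:R + a / pi) / l%:R[%classic.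
    have E (u : R) : j%:R <= l%:R * u -> l%:R * u < j%:R + 1 ->
        (t < cos (pi * l%:R * u)) = (l%:R * u < j%:R + a / pi).
      move=> u1 u2; rewrite cosE -signr_odd (negbTE oj) expr0 mul1r.
      rewrite -ca ltr_cos//; last first.
        by rewrite in_itv/=; apply/andP; split; nra.
      by rewrite -ltrBlDl [RHS]ltr_pdivlMr// [in RHS]mulrC.
    apply/seteqP; split => u /=; rewrite !in_itv/= !ltr_pdivlMr// ?ler_pdivrMr//.
    + by move=> [/andP[u1 u2]]; rewrite /above/= E ?[l%:R * u]mulrC// => ->; rewrite u1.
    + move=> /andP[u1 u2].
      have ju : u * l%:R < j%:R + 1.
        apply: lt_le_trans u2 _; rewrite lerD2l.
        by rewrite ler_pdivrMr// mul1r.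
      by rewrite ju u1 /above/= E ?[l%:R * u]mulrC.
  rewrite lebesgue_measure_itv/= lte_fin ifT; last first.
    by rewrite ltr_pM2r ?invr_gt0// ltrDl divr_gt0.
  by rewrite -EFinD len.
Qed.

Lemma mu_cos_periods (l n : nat) (t : R) : (0 < l)%N ->
  mu (`[0, n%:R / l%:R[ `&` above l t) =
  (n%:R * (acos (clip t) / (pi * l%:R)))%:E.
Proof.
move=> l0; have l0' : 0 < l%:R :> R by rewrite ltr0n.
elim: n => [|n IH].
  by rewrite mul0r mul0r set_itv_ge ?bnd_simp ?ltxx// set0I measure0.
have -> : `[0, n.+1%:R / l%:R[ `&` above l t =
    (`[0, n%:R / l%:R[ `&` above l t) `|`
    (`[n%:R / l%:R, n.+1%:R / l%:R[ `&` above l t).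
  rewrite -setIUl; congr (_ `&` _).
  rewrite -itv_bndbnd_setU// bnd_simp ?divr_ge0//.
  by rewrite ler_pM2r ?invr_gt0// ler_nat.
rewrite measureU//; last 3 first.
- by apply: measurableI => //; exact: measurable_above.
- by apply: measurableI => //; exact: measurable_above.
- apply/seteqP; split => // u [] [] /=; rewrite !in_itv/= => /andP[_ u1] _ [] /andP[u2 _] _.
  by move: (lt_le_trans u1 u2); rewrite ltxx.
have nS : n.+1%:R = n%:R + 1 :> R by rewrite natr1.
rewrite /= in IH *; rewrite IH mu_cos_period// -EFinD nS; congr EFin.
by move: (_ / (pi * _)) => q; ring.
Qed.

(** [Pu] is carried by [[0, 1]], the range where the cosine formula for [Ycoef] holds. *)
Lemma Pu_eq (A B : set R) : (forall u, 0 <= u -> u <= 1 -> A u <-> B u) ->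
  Pu R A = Pu R B.
Proof.
move=> AB; rewrite /Pu /= /uniform_prob integral_uniform_pdf [RHS]integral_uniform_pdf.
suff -> : A `&` `[0%R, 1%R] = B `&` `[0%R, 1%R] by [].
by apply/seteqP; split => u /= [Au ui]; split => //; move: (ui);
  rewrite in_itv/= => /andP[u0 u1]; exact/(AB u u0 u1).
Qed.

Lemma Pu_mu (A : set R) : measurable A -> Pu R A = mu (`[0, 1[ `&` A).
Proof.
move=> mA; rewrite /Pu /= /uniform_prob integral_uniform_pdf.
rewrite (eq_integral (cst 1%E)); last first.
  by move=> u; rewrite inE/= in_itv/= /uniform_pdf => -[_ ->]; rewrite subr0 invr1.
rewrite integral_cst/= ?mul1e; last exact: measurableI.
have -> : A `&` `[0, 1] = (`[0, 1[ `&` A) `|` ([set 1] `&` A).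
  rewrite -setIUl setIC; congr (_ `&` _).
  by rewrite setUitv1// bnd_simp.
rewrite measureU0//; try exact: measurableI.
apply/eqP; rewrite eq_le measure_ge0 andbT -(lebesgue_measure_set1 (1 : R)).
by apply: le_measure; rewrite ?inE//; exact: measurableI.
Qed.

(** Exactly [l] half-periods fill [[0, 1[], each contributing [S b / l]; the law therefore does not
    depend on [l]. *)
Lemma Pu_cos_lt (l : nat) (b : R) : (0 < l)%N ->
  Pu R [set u | - sqrt2 * cos (pi * l%:R * u) < b] = (S b)%:E.
Proof.
move=> l0; have l0' : 0 < l%:R :> R by rewrite ltr0n.
have -> : [set u | - sqrt2 * cos (pi * l%:R * u) < b] = above l (- b / sqrt2).
  apply/seteqP; split => u; rewrite /above /= ltr_pdivrMr ?sqrt2_gt0// mulNr ltrNl mulrC//.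
rewrite Pu_mu; last exact: measurable_above.
have := mu_cos_periods l l (- b / sqrt2) l0; rewrite divff ?gt_eqF// => ->.
congr EFin; rewrite /arcsine_cdf; rewrite invfM mulrC -!mulrA.
by rewrite mulVf ?mulr1// gt_eqF.
Qed.

Lemma Pu_cos_itv (l : nat) (a b : R) : (0 < l)%N -> a <= b ->
  Pu R [set u | a <= - sqrt2 * cos (pi * l%:R * u) < b] = (S b - S a)%:E.
Proof.
move=> l0 ab.
have m c : measurable [set u | - sqrt2 * cos (pi * l%:R * u) < c].
  have -> : [set u | - sqrt2 * cos (pi * l%:R * u) < c] = above l (- c / sqrt2).
    apply/seteqP; split => u; rewrite /above /= ltr_pdivrMr ?sqrt2_gt0// mulNr ltrNl mulrC//.
  exact: measurable_above.
have -> : [set u | a <= - sqrt2 * cos (pi * l%:R * u) < b] =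
  [set u | - sqrt2 * cos (pi * l%:R * u) < b] `\` [set u | - sqrt2 * cos (pi * l%:R * u) < a].
  apply/seteqP; split => u /=.
    by move=> /andP[h1 ->]; split => //; rewrite ltNge h1.
  by move=> [-> /negP]; rewrite -leNgt => ->.
rewrite measureD; [|exact: m|exact: m|by rewrite [ltLHS](Pu_cos_lt l b l0) ltry].
rewrite setIidr; first by rewrite [X in (X - _)%E](Pu_cos_lt l b l0) [X in (_ - X)%E](Pu_cos_lt l a l0).
by move=> u /= /lt_le_trans; apply.
Qed.

(** Rounding to [n] confines [pi * l * Y] to the cell of length [a] centred at [(n - v) * a], closed
    on the left because ties round up. Its probability is the increment of [S], that is [a * q]. *)
Lemma Pu_quantized (l : nat) (d v : R) (n : int) : (0 < l)%N -> 0 < d ->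
  let a := pi * l%:R * d in
  fine (Pu R [set u | round_near (Ycoef l u / d + v) = n]) =
  a * dith_dens a ((n%:~R - v) * a).
Proof.
move=> l0 d0 a.
have l0' : 0 < l%:R :> R by rewrite ltr0n.
have a0 : 0 < a by rewrite !mulr_gt0// pi_gt0.
rewrite (@Pu_eq _ [set u | (n%:~R - v) * a - a / 2 <=
   - sqrt2 * cos (pi * l%:R * u) < (n%:~R - v) * a + a / 2]).
  rewrite Pu_cos_itv//=; last by lra.
  by rewrite /dith_dens [RHS]mulrC divfK// gt_eqF.
move=> u u0 u1 /=; rewrite Ycoef_cos// /round_near.
set W := - sqrt2 * _.
have -> : W / (pi * l%:R) / d = W / a by rewrite /a [in RHS]invfM mulrA.
split.
- move/eqP; rewrite floor_eq intrD => /andP[h1 h2].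
  have {}h1 : n%:~R - v - 2^-1 <= W / a by lra.
  have {}h2 : W / a < n%:~R - v + 2^-1 by lra.
  move: h1 h2; rewrite ler_pdivlMr// ltr_pdivrMr// => h1 h2.
  by apply/andP; split; lra.
- move=> /andP[h1 h2]; apply/eqP; rewrite floor_eq intrD.
  have {}h1 : n%:~R - v - 2^-1 <= W / a by rewrite ler_pdivlMr//; lra.
  have {}h2 : W / a < n%:~R - v + 2^-1 by rewrite ltr_pdivrMr//; lra.
  by apply/andP; split; lra.
Qed.

End cosine_law.

(** * Conditional entropy given the dither *)

Section conditional_entropy.
Context {R : realType}.
Notation mu := (@lebesgue_measure R).
Notation sqrt2 := (Num.sqrt (2 : R)).

Lemma esum_int_window (e : int -> \bar R) (M : nat) :
  (forall n, (0 <= e n)%E) -> (forall n : int, (M < `|n|)%N -> e n = 0%E) ->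
  (\esum_(n in [set: int]) e n = \sum_(i < (M + M).+1) e (i%:Z - M%:Z)%R)%E.
Proof.
move=> e_ge0 e0; pose w (i : nat) : int := i%:Z - M%:Z.
transitivity (\esum_(n in w @` `I_(M + M).+1) e n)%E.
  rewrite [RHS]esum_mkcond; apply: eq_esum => n _.
  case: ifPn => //; rewrite notin_setE => nw; apply: e0.
  rewrite ltnNge; apply/negP => nM; apply: nw.
  by exists `|(n + M%:Z)%R|%N; rewrite /w/=; lia.
rewrite esum_image; last by move=> i j _ _; rewrite /w; lia.
rewrite esum_fset; [|exact: finite_II|by []].
by rewrite -fsbig_ord.
Qed.

(** For [|n| > M] and [|v| <= V], the centre [(n - v) * a] is at distance at least [(M + 1 - V) * a]
    from 0, outside the support of [q]. One window thus serves all [|v| <= V]: [V = 1/2] for the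
    average, a larger [V] for continuity at a given point. *)
Lemma dentropy_quantized (l : nat) (d v V : R) (M : nat) : (0 < l)%N -> 0 < d ->
  let a := pi * l%:R * d in
  `|v| <= V -> sqrt2 + a / 2 <= (M%:R + 1 - V) * a ->
  dentropy (fun u => round_near (Ycoef l u / d + v)) =
  \sum_(i < (M + M).+1) ent_term (a * dith_dens a ((i%:R - M%:R - v) * a)).
Proof.
move=> l0 d0 a vV MV.
have a0 : 0 < a by rewrite !mulr_gt0// ?pi_gt0// ltr0n.
rewrite /dentropy (@esum_int_window _ M).
- rewrite sumEFin /=; apply: eq_bigr => i _.
  by rewrite Pu_quantized// -/a rmorphB.
- move=> n; rewrite Pu_quantized// -/a lee_fin; apply: ent_term_ge0.
    by rewrite mulr_ge0 ?(ltW a0)// dith_dens_ge0.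
  exact: dith_densM_le1.
- move=> n nM; rewrite Pu_quantized// -/a dith_dens_out ?mulr0 ?ent_term0//.
  apply: le_trans MV _; rewrite normrM (gtr0_norm a0) ler_pM2r//.
  apply: le_trans (lerB_dist _ _); apply: lerB => //.
  have -> : `|n%:~R| = `|n|%N%:R :> R by rewrite -intr_norm -abszE.
  by rewrite natr1 ler_nat.
Qed.

Lemma continuous_window (a : R) (M : nat) : continuous (fun v : R =>
  \sum_(i < (M + M).+1) ent_term (a * dith_dens a ((i%:R - M%:R - v) * a))).
Proof.
apply: continuous_sum => i v.
apply: (@cvg_comp _ _ _ _ (@ent_term R) _ _ _ _ (continuous_ent_term _)).
apply: cvgM; first exact: cvg_cst.
apply: (@cvg_comp _ _ _ _ (dith_dens a) _ _ _ _ (continuous_dith_dens _ _)).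
by apply: cvgM; [apply: cvgB; [exact: cvg_cst|exact: cvg_id]|exact: cvg_cst].
Qed.

(** Supplies the measurability in [v] of the integrand defining the conditional entropy. Near [v0]
    the entropy is a finite sum over a fixed window. *)
Lemma continuous_dentropy_quantized (l : nat) (d : R) : (0 < l)%N -> 0 < d ->
  continuous (fun v => dentropy (fun u => round_near (Ycoef l u / d + v))).
Proof.
move=> l0 d0 v0; pose a := pi * l%:R * d.
have a0 : 0 < a by rewrite !mulr_gt0// ?pi_gt0// ltr0n.
pose V := `|v0| + 1; pose M := Num.bound ((sqrt2 + a / 2) / a + V).
have MV : sqrt2 + a / 2 <= (M%:R + 1 - V) * a.
  rewrite -ler_pdivrMr//.
  have : (sqrt2 + a / 2) / a + V < M%:R.
    apply: archi_boundP; rewrite addr_ge0// ?addr_ge0// divr_ge0 ?(ltW a0)//.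
    by rewrite addr_ge0// ?sqrtr_ge0// divr_ge0// ltW.
  lra.
have v0V : `|v0| <= V by rewrite lerDl.
rewrite /continuous_at (dentropy_quantized l d v0 V M)//.
apply: cvg_trans (continuous_window a M v0).
apply: near_eq_cvg; near=> v.
rewrite (dentropy_quantized l d v V M)//.
rewrite -(subrK v0 v) (le_trans (ler_normD _ _))// addrC lerD2l.
by near: v; exists 1 => //= w; rewrite distrC => /ltW.
Unshelve. all: by end_near. Qed.

Lemma cond_entropy_quantized (l : nat) (d : R) : (0 < l)%N -> 0 < d ->
  cond_entropy_dither (fun u v => round_near (Ycoef l u / d + v)) =
  diff_entropy (dith_dens (pi * l%:R * d)) - log2 (pi * l%:R * d).
Proof.
move=> l0 d0; set a := pi * l%:R * d.
have a0 : 0 < a by rewrite !mulr_gt0// ?pi_gt0// ltr0n.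
pose M := Num.bound (sqrt2 / a).
have Ma : sqrt2 <= M%:R * a.
  rewrite -ler_pdivrMr//; apply/ltW/archi_boundP.
  by rewrite divr_ge0 ?sqrtr_ge0// ltW.
rewrite -(dithered_entropy a M)// /cond_entropy_dither /Pv {1}/Rintegral.
rewrite integral_uniform.
- rewrite opprK (_ : 2^-1 + 2^-1 = 1 :> R); last lra.
  rewrite invr1 mul1e -/(Rintegral _ _ _); apply: eq_Rintegral => v.
  rewrite mem_setE in_itv/= => vI.
  by rewrite (dentropy_quantized l d v 2^-1 M)// ?ler_norml// -/a; lra.
- apply/measurable_EFinP; apply: continuous_measurable_fun.
  exact: continuous_dentropy_quantized.
- move=> v; rewrite lee_fin /dentropy.
  apply: fine_ge0; apply: esum_ge0 => n _; rewrite lee_fin Pu_quantized//.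
  apply: ent_term_ge0; last exact: dith_densM_le1.
  by rewrite mulr_ge0 ?(ltW a0)// dith_dens_ge0.
Qed.

Lemma HbarE (gamma Delta : R) : 0 < gamma -> 0 < Delta ->
  Hbar gamma Delta =
  \sum_(1 <= l < (Kpar Delta).+1)
    (diff_entropy (dith_dens (Num.sqrt (12 * gamma) * pi * l%:R / (Kpar Delta)%:R))
     - log2 (Num.sqrt (12 * gamma) * pi * l%:R / (Kpar Delta)%:R)).
Proof.
move=> g0 D0; rewrite /Hbar; apply: eq_big_nat => l /andP[l0 lK].
have K0 : 0 < (Kpar Delta)%:R :> R by rewrite ltr0n; exact: leq_trans l0 _.
rewrite cond_entropy_quantized//; last first.
  by rewrite divr_gt0// sqrtr_gt0 mulr_gt0.
suff -> : pi * l%:R * deltapar gamma Delta =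
  Num.sqrt (12 * gamma) * pi * l%:R / (Kpar Delta)%:R by [].
by rewrite /deltapar mulrA; congr (_ / _); rewrite mulrC mulrA.
Qed.

End conditional_entropy.

(** * Riemann sums of functions singular at 0 *)

Section riemann_sums.
Context {R : realType}.
Notation mu := (@lebesgue_measure R).

(** The sum is the integral of a step function sampling [G] at right endpoints. The sample point
    [y n x] of the cell of [x] is at least [x] and tends to it, so bounding [G] on [[x, 1]] by [h x]
    and continuity from above are what dominated convergence uses. *)
Lemma cvg_riemann_sum (G h : R -> R) :
  mu.-integrable `]0, 1] (EFin \o h) ->
  (forall x y : R, 0 < x -> x <= y -> y <= 1 -> `|G y| <= h x) ->
  (forall (y_ : nat -> R) (x : R), 0 < x -> (forall n, x <= y_ n <= 1) ->
    y_ @ \oo --> x -> G (y_ n) @[n --> \oo] --> G x) ->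
  n.+1%:R^-1 * (\sum_(i < n.+1) G (i.+1%:R / n.+1%:R)) @[n --> \oo] -->
  Rintegral mu `[0, 1] G.
Proof.
move=> ih Gh cG.
have N0 n : 0 < n.+1%:R :> R by rewrite ltr0n.
pose A n i : set R := `](i%:R / n.+1%:R), (i.+1%:R / n.+1%:R)]%classic.
pose g n x := \sum_(i < n.+1) G (i.+1%:R / n.+1%:R) * \1_(A n i) x.
pose y n (x : R) : R := (Num.ceil (n.+1%:R * x))%:~R / n.+1%:R.
have yge n x : x <= y n x by rewrite ler_pdivlMr// mulrC ceil_ge.
have yle n x : y n x <= x + n.+1%:R^-1.
  rewrite ler_pdivrMr// mulrDl mulVf ?gt_eqF// -lerBlDr [x * _]mulrC.
  by have := ltW (ceilB1_lt (n.+1%:R * x)); rewrite rmorphB/=.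
have y1 n x : x <= 1 -> y n x <= 1.
  move=> x1; rewrite ler_pdivrMr// mul1r.
  rewrite (_ : n.+1%:R = n.+1%:Z%:~R :> R)// ler_int ceil_le_int.
  by rewrite -[leRHS]mulr1 ler_pM2l.
have inA n j x : (x \in A n j) = (Num.ceil (n.+1%:R * x) == j.+1%:Z).
  rewrite mem_setE in_itv/= ltr_pdivrMr// ler_pdivlMr// [x * _]mulrC ceil_eq.
  by rewrite (_ : (j.+1%:Z - 1)%:~R = j%:R :> R)// -addn1 PoszD addrK.
have gE n x : 0 < x -> x <= 1 -> g n x = G (y n x).
  (* The only cell containing [x] has index [k - 1]; [x > 0] makes [k] positive and [x <= 1] keeps
     it at most [n + 1]. *)
  move=> x0 x1; pose k := Num.ceil (n.+1%:R * x).
  have k0 : 0 < k by rewrite ceil_gt0 mulr_gt0.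
  have kN : k <= n.+1%:Z by rewrite ceil_le_int -[leRHS]mulr1 ler_pM2l.
  have jN : (`|k|.-1 < n.+1)%N by lia.
  have kE : k = (`|k|.-1).+1%:Z by lia.
  rewrite /g (bigD1 (Ordinal jN))//= big1 ?addr0; last first.
    move=> j jk; rewrite indicE inA -/k; case: eqP => [kj|_]; last by rewrite mulr0.
    by move: jk; rewrite -val_eqE/= kj/= eqxx.
  by rewrite indicE inA -/k -kE eqxx mulr1 /y -/k [in RHS]kE.
have mA n i : measurable (A n i) by exact: measurable_itv.
have iA n i : mu.-integrable `]0, 1] (EFin \o \1_(A n i)).
  by apply: integrableS (integrable_indic_itv _ _ _ _) => //; exact: measurableT.
have mg n : measurable_fun (`]0, 1]%classic : set R) (EFin \o g n).
  apply/measurable_EFinP; apply: measurable_sum => i.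
  apply: measurable_funM; first exact: measurable_cst.
  exact: measurable_indic.
have gint n : (\int[mu]_(x in `]0%R, 1%R]) (EFin \o g n) x =
    (n.+1%:R^-1 * \sum_(i < n.+1) G (i.+1%:R / n.+1%:R))%:E)%E.
  transitivity (\int[mu]_(x in `]0%R, 1%R]) (\sum_(i < n.+1)
      (G (i.+1%:R / n.+1%:R))%:E * (EFin \o \1_(A n i)) x))%E.
    by apply: eq_integral => x _; rewrite /g /= -sumEFin; apply: eq_bigr => i _; rewrite EFinM.
  rewrite integral_sum//; last by move=> i; exact: integrableZl.
  rewrite mulr_sumr -sumEFin; apply: eq_bigr => i _.
  have muA : (\int[mu]_(x in `]0%R, 1%R]) (EFin \o \1_(A n i)) x = mu (A n i))%E.
    transitivity (mu (A n i `&` `]0, 1])); first by apply: integral_indic; exact: measurable_itv.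
    congr (mu _); apply: setIidl => x; rewrite /A /= !in_itv/= => /andP[h1 h2].
    apply/andP; split.
      by apply: le_lt_trans h1; rewrite divr_ge0.
    by apply: le_trans h2 _; rewrite ler_pdivrMr// mul1r ler_nat.
  rewrite integralZl// muA.
  rewrite lebesgue_measure_itv/= lte_fin ltr_pM2r ?invr_gt0// ltr_nat ltnSn.
  rewrite -EFinD -EFinM mulrC -mulrBl; congr (_ * _)%:E.
  by rewrite -natrB// subSnn mul1r.
have gcvg x : 0 < x -> x <= 1 -> g n x @[n --> \oo] --> G x.
  move=> x0 x1; under eq_fun do rewrite gE//.
  apply: (cG (fun n => y n x)) => //; first by move=> n; rewrite yge y1.
  apply: (@squeeze_cvgr _ _ _ _ (cst x) (fun n => x + n.+1%:R^-1)).
  - by near=> n; rewrite yge yle.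
  - exact: cvg_cst.
  - rewrite -[X in _ --> X]addr0; apply: cvgD; first exact: cvg_cst.
    exact: cvg_harmonic.
have gcvgE x : `]0, 1]%classic x -> (EFin \o g n) x @[n --> \oo] --> (EFin \o G) x.
  rewrite /= in_itv/= => /andP[x0 x1].
  by apply: cvg_EFin; [exact: nearW|exact: gcvg].
have [] := @dominated_convergence _ _ R mu `]0, 1] (measurable_itv _)
  (fun n => EFin \o g n) (EFin \o G) (EFin \o h).
- exact: mg.
- exact: (emeasurable_fun_cvg (fun n => EFin \o g n)).
- exact: aeW.
- exact: ih.
- apply: aeW => x n; rewrite /= in_itv/= => /andP[x0 x1].
  by rewrite lee_fin gE// Gh ?y1.
move=> iG _ hcv.
rewrite -Rintegral_itv_obnd_cbnd//.
have hcv' : (n.+1%:R^-1 * (\sum_(i < n.+1) G (i.+1%:R / n.+1%:R)))%:E @[n --> \oo] -->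
    (Rintegral mu `]0, 1] G)%:E.
  rewrite /Rintegral fineK; last exact: integrable_fin_num.
  by apply: cvg_trans hcv; apply: near_eq_cvg; near=> n; rewrite -gint.
exact: (fine_cvg hcv').
Unshelve. all: by end_near. Qed.

End riemann_sums.

(** * The integral of the logarithm on the unit interval *)

Section logarithm.
Context {R : realType}.
Notation mu := (@lebesgue_measure R).

(** The antiderivative [x - x * ln x] is continuous at 0 by [continuous_xlnx]; the sign makes the
    integrand nonnegative. *)
Let integral_oppr_ln : (\int[mu]_(x in `]0%R, 1%R[) (- ln x)%:E = 1)%E.
Proof.
rewrite (@ge0_continuous_FTC2_oo R (fun x => - ln x) (fun x => x - x * ln x))//.
- by rewrite ln1 mulr0 mul0r !subr0.
- by move=> x; rewrite in_itv/= => /andP[x0 x1]; rewrite oppr_ge0 ln_le0// ltW.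
- move=> x; rewrite in_itv/= => /andP[x0 x1].
  by apply: cvgN; exact: continuous_ln.
- by move=> x; apply: cvgB; [exact: cvg_id|exact: continuous_xlnx].
- move=> x; rewrite in_itv/= => /andP[x0 x1].
  have dl := is_derive1_ln x0.
  apply: is_derive_eq; rewrite /GRing.scale/= mulr1 divff ?gt_eqF//; ring.
Qed.

Lemma integrable_ln : mu.-integrable `]0, 1] (EFin \o @ln R).
Proof.
apply/integrableP; split.
  by apply/measurable_EFinP; apply: measurable_funS (@measurable_ln R).
rewrite -integral_itv_bndo_bndc; last first.
  apply/measurable_EFinP; apply: measurableT_comp => //.
  by apply: measurable_funS (@measurable_ln R).
suff -> : (\int[mu]_(x in `]0%R, 1%R[) `|(EFin \o @ln R) x| = 1)%E by rewrite ltry.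
rewrite -integral_oppr_ln; apply: eq_integral => x; rewrite mem_setE in_itv/= => /andP[x0 x1].
by rewrite /= ler0_norm// ln_le0// ltW.
Qed.

Lemma Rintegral_ln : Rintegral mu `[0, 1] (@ln R) = -1.
Proof.
rewrite /Rintegral integral_itv_bndoo; last first.
  by apply/measurable_EFinP; apply: measurable_funS (@measurable_ln R).
transitivity (fine (\int[mu]_(x in `]0%R, 1%R[) (- (- ln x)%:E))%E).
  by congr fine; apply: eq_integral => x _; rewrite -EFinN opprK.
rewrite integral_ge0N ?integral_oppr_ln//.
move=> x /=; rewrite in_itv/= => /andP[x0 x1].
by rewrite lee_fin oppr_ge0 ln_le0// ltW.
Qed.

Lemma cvg_riemann_sum_ln :
  n.+1%:R^-1 * (\sum_(i < n.+1) ln (i.+1%:R / n.+1%:R)) @[n --> \oo] --> (-1 : R).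
Proof.
rewrite -Rintegral_ln; apply: (@cvg_riemann_sum R _ (fun x => - ln x)).
- rewrite (_ : _ \o _ = (fun x => - (EFin \o @ln R) x)%E); last first.
    by apply/funext => x /=; rewrite EFinN.
  exact: integrableN integrable_ln.
- move=> x y x0 xy y1; have y0 : 0 < y := lt_le_trans x0 xy.
  by rewrite ler0_norm ?ln_le0// lerN2 ler_ln.
- move=> y_ x x0 _ cv.
  exact: (@cvg_comp _ _ _ _ (@ln R) _ _ _ cv (continuous_ln x0)).
Qed.

End logarithm.

(** * Limit of the mean dithered entropy *)

Section entropy_riemann_sum.
Context {R : realType}.
Notation mu := (@lebesgue_measure R).
Notation sqrt2 := (Num.sqrt (2 : R)).

Lemma cvg_riemann_sum_diff_entropy (c : R) : 0 < c ->
  n.+1%:R^-1 * (\sum_(i < n.+1) diff_entropy (dith_dens (c * (i.+1%:R / n.+1%:R))))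
    @[n --> \oo] -->
  Rintegral mu `[0, 1] (fun x => diff_entropy (dith_dens (c * x))).
Proof.
move=> c0; have l2 := @ln2_gt0 R.
(* For [x <= y <= 1], [diff_entropy_ge] gives the lower bound [log2 (c * y) >= log2 (c * x)] and
   [diff_entropy_le] the upper bound [(2 * sqrt2 + c) / ln 2]; this [C] covers both. *)
pose C := `|ln c| + 2 * sqrt2 + c.
apply: (@cvg_riemann_sum R (fun x => diff_entropy (dith_dens (c * x)))
  (fun x => (C - ln x) / ln 2)).
- rewrite (_ : _ \o _ = (fun x => (ln 2)^-1%:E * ((C%:E) - (EFin \o @ln R) x))%E); last first.
    by apply/funext => x /=; rewrite -EFinB -EFinM mulrC.
  apply: integrableZl => //; apply: integrableB => //; last exact: integrable_ln.
  apply: (@integrableS _ _ _ mu `[0, 1]) => //; first exact: subset_itv_oc_cc.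
  exact: (@continuous_integrable_itv R (cst C) 0 1 (fun=> cvg_cst _)).
- move=> x y x0 xy y1; have y0 : 0 < y := lt_le_trans x0 xy.
  have cy0 : 0 < c * y by rewrite mulr_gt0.
  have lnx : ln x <= 0 by rewrite ln_le0// (le_trans xy).
  have lnxy : ln x <= ln y by rewrite ler_ln.
  have lnc := ler_norm (- ln c); rewrite normrN in lnc.
  rewrite ler_norml -mulNr; apply/andP; split.
    apply: le_trans (diff_entropy_ge _ cy0).
    rewrite /log2 ler_pM2r ?invr_gt0// lnM ?posrE// /C.
    have : 0 <= sqrt2 by rewrite sqrtr_ge0.
    by lra.
  apply: le_trans (diff_entropy_le _ cy0) _.
  rewrite ler_pM2r ?invr_gt0// /C.
  have : c * y <= c by rewrite ger_pMr.
  by have := normr_ge0 (ln c); lra.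
- move=> y_ x x0 yx cv.
  apply: (@cvg_diff_entropy R (fun n => c * y_ n) (c * x) c).
  + by rewrite mulr_gt0.
  + by move=> n; rewrite ler_pM2l//; have /andP[] := yx n.
  + by move=> n; rewrite ger_pMr//; have /andP[] := yx n.
  + by apply: cvgM => //; exact: cvg_cst.
Qed.

(** The logarithm splits into [ln c] and [ln (i.+1 / n.+1)]. The mean of the latter tends to -1, the
    source of the factor [e] in the limit. *)
Lemma cvg_mean_dithered_entropy (c : R) : 0 < c ->
  n.+1%:R^-1 * (\sum_(i < n.+1)
     (diff_entropy (dith_dens (c * (i.+1%:R / n.+1%:R))) - log2 (c * (i.+1%:R / n.+1%:R))))
    @[n --> \oo] -->
  Rintegral mu `[0, 1] (fun x => diff_entropy (dith_dens (c * x)))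
    - log2 (c / expR 1).
Proof.
move=> c0; have l2 := @ln2_gt0 R.
rewrite /log2 ln_div ?posrE ?expR_gt0// expRK.
have -> : (fun n => n.+1%:R^-1 * (\sum_(i < n.+1)
     (diff_entropy (dith_dens (c * (i.+1%:R / n.+1%:R)))
      - ln (c * (i.+1%:R / n.+1%:R)) / ln 2))) =
  (fun n => n.+1%:R^-1 * (\sum_(i < n.+1) diff_entropy (dith_dens (c * (i.+1%:R / n.+1%:R))))
    - (ln c + n.+1%:R^-1 * (\sum_(i < n.+1) ln (i.+1%:R / n.+1%:R))) / ln 2).
  apply/funext => n; rewrite sumrB mulrBr; congr (_ - _).
  rewrite -mulr_suml mulrA; congr (_ / _).
  rewrite (eq_bigr (fun i : 'I_n.+1 => ln c + ln (i.+1%:R / n.+1%:R))).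
    rewrite big_split/= mulrDr sumr_const card_ord; congr (_ + _).
    by rewrite -[ln c *+ _]mulr_natl mulKf// pnatr_eq0.
  by move=> i _; rewrite lnM// posrE divr_gt0.
apply: cvgB; first exact: cvg_riemann_sum_diff_entropy.
apply: cvgM; last exact: cvg_cst.
by apply: cvgD; [exact: cvg_cst|exact: cvg_riemann_sum_ln].
Qed.

End entropy_riemann_sum.

(** * Asymptotics of the number of coefficients *)

Section number_of_coefficients.
Context {R : realType}.

(** Since [Num.sqrt (Dpar Delta) = Delta * pi / 2], [Kpar] is the ceiling of
    [2 / (Delta * pi ^+ 2)], and the ceiling adds at most 1. *)
Lemma Kpar_itv (Delta : R) : 0 < Delta ->
  2 / pi ^+ 2 <= Delta * (Kpar Delta)%:R <= 2 / pi ^+ 2 + Delta.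
Proof.
move=> D0; have p0 := @pi_gt0 R.
have sD : Num.sqrt (Dpar Delta) = Delta * pi / 2.
  rewrite (_ : Dpar Delta = (Delta * pi / 2) ^+ 2).
    by rewrite sqrtr_sqr ger0_norm// divr_ge0// mulr_ge0// ltW.
  by rewrite /Dpar; move: (@pi R) => p; field.
pose t : R := (pi * (Delta * pi / 2))^-1.
have t0 : 0 < t by rewrite invr_gt0 !mulr_gt0// invr_gt0.
have Dt : Delta * t = 2 / pi ^+ 2.
  by rewrite /t; move: (@pi R) p0 => p p0; field; rewrite !gt_eqF.
have -> : (Kpar Delta)%:R = (Num.ceil t)%:~R :> R.
  by rewrite /Kpar sD -/t natr_absz gtr0_norm// ceil_gt0.
rewrite -Dt -[X in _ + X]mulr1 -mulrDr !ler_pM2l//.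
have /andP[h1 h2] := ceil_itv t.
by rewrite h2 -lerBlDr ltW//; move: h1; rewrite rmorphB.
Qed.

Lemma Kpar_gt0 (Delta : R) : 0 < Delta -> (0 < Kpar Delta)%N.
Proof.
move=> D0; have /andP[h _] := Kpar_itv _ D0; rewrite lt0n; apply/eqP => K0.
move: h; rewrite K0 mulr0 leNgt; apply/negP/negPn.
by rewrite divr_gt0// exprn_gt0// pi_gt0.
Qed.

Lemma cvg_mul_Kpar :
  Delta * (Kpar Delta)%:R @[Delta --> (0 : R)^'+] --> (2 / pi ^+ 2 : R).
Proof.
apply: (@squeeze_cvgr _ _ _ _ (cst (2 / pi ^+ 2)) (fun Delta => 2 / pi ^+ 2 + Delta)).
- by near=> Delta; exact: Kpar_itv.
- exact: cvg_cst.
- rewrite -[X in _ --> X]addr0; apply: cvgD; first exact: cvg_cst.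
  by apply: cvg_at_right_filter; exact: cvg_id.
Unshelve. all: by end_near. Qed.

Lemma cvg_Kpar_pred : (@Kpar R Delta).-1 @[Delta --> (0 : R)^'+] --> \oo.
Proof.
move=> P [N _ NP].
(* Below this threshold [Kpar Delta > N + 2], so the predecessor exceeds [N]. *)
have e0 : 0 < 2 / pi ^+ 2 / N.+2%:R :> R.
  by rewrite !divr_gt0// exprn_gt0// pi_gt0.
suff: \forall Delta \near (0 : R)^'+, P (Kpar Delta).-1 by [].
near=> Delta; apply: NP => /=.
have D0 : 0 < Delta by near: Delta; exact: nbhs_right_gt.
have De : Delta < 2 / pi ^+ 2 / N.+2%:R by near: Delta; exact: nbhs_right_lt.
have /andP[h _] := Kpar_itv _ D0.
have : (N.+2%:R : R) < (Kpar Delta)%:R.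
  rewrite -(ltr_pM2l D0); apply: lt_le_trans h.
  by rewrite -ltr_pdivlMr.
by rewrite ltr_nat; lia.
Unshelve. all: by end_near. Qed.

End number_of_coefficients.

(** * The entropy formula and its limit *)

Theorem theorem3 (R : realType) (gamma : R)
  (gamma_pos : 0 < gamma)
  (gamma_def : atan (pi * Num.sqrt gamma) = (pi * Num.sqrt gamma)^-1) :
  (forall Delta : R, 0 < Delta -> Delta < 6^-1 ->
     Hbar gamma Delta =
     \sum_(1 <= l < (Kpar Delta).+1)
       (diff_entropy (convol (@arcsine_dens R)
          (unif_dens (Num.sqrt (12 * gamma) * pi * l%:R / (Kpar Delta)%:R)))
        - log2 (pi * l%:R * Num.sqrt (12 * gamma) / (Kpar Delta)%:R)))
  /\
  (fun Delta => Delta * Hbar gamma Delta) x @[x --> (0 : R)^'+] -->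
    2 / pi ^+ 2 *
    (Rintegral (@lebesgue_measure R) `[0, 1]
       (fun x => diff_entropy (convol (@arcsine_dens R)
                   (unif_dens (pi * x * Num.sqrt (12 * gamma)))))
     - log2 (pi * Num.sqrt (12 * gamma) / expR 1)).
Proof.
have p0 := @pi_gt0 R.
have g0 : 0 < Num.sqrt (12 * gamma) by rewrite sqrtr_gt0 mulr_gt0.
split.
  move=> Delta D0 _; rewrite HbarE//; apply: eq_big_nat => l _.
  rewrite convol_arcsine_unif; last first.
    by rewrite divr_ge0// !mulr_ge0// ltW.
  by congr (_ - log2 (_ / _)); rewrite -mulrA mulrC.
pose c := pi * Num.sqrt (12 * gamma); have c0 : 0 < c by rewrite mulr_gt0.
rewrite (_ : Rintegral _ _ _ = Rintegral (@lebesgue_measure R) `[0, 1]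
    (fun x => diff_entropy (dith_dens (c * x)))); last first.
  apply: eq_Rintegral => x; rewrite mem_setE in_itv/= => /andP[x0 _].
  rewrite convol_arcsine_unif; first by rewrite mulrAC.
  by rewrite !mulr_ge0// ltW.
(* The means are indexed by [n.+1] terms, hence the substitution [n = Kpar Delta - 1]. Then
   [Delta * Hbar] is [Delta * K] times the mean of the [K] summands, a product of two convergent
   factors. *)
have cvK := @cvg_comp _ _ _ _ _ _ _ _ (@cvg_Kpar_pred R)
  (cvg_mean_dithered_entropy c c0).
apply: cvg_trans (cvgM (@cvg_mul_Kpar R) cvK).
apply: near_eq_cvg; near=> Delta.
have D0 : 0 < Delta by near: Delta; exact: nbhs_right_gt.
have K0 := Kpar_gt0 _ D0.
rewrite HbarE// /= !prednK// mulrA mulfK ?pnatr_eq0 -?lt0n//; congr (_ * _).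
rewrite big_add1 big_mkord; apply: eq_bigr => i _.
suff -> : c * (i.+1%:R / (Kpar Delta)%:R) =
  Num.sqrt (12 * gamma) * pi * i.+1%:R / (Kpar Delta)%:R by [].
by rewrite mulrA /c [pi * _]mulrC.
Unshelve. all: by end_near. Qed.
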